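(* Let $A$ be a complete commutative local ring with maximal ideal $\mathfrak r$, in which $2$ is a unit, with a ramified involution $*$. Let $V$ be a free $A$-module of finite rank $m>0$, let $h:V\times V\to A$ be a skew hermitian form, and let $u,v\in V$ be such that $h(u,v)$ is a unit of $A$. Then there is a symplectic pair $(u',v')\in V^2$ such that $Au'+Av'=Au+Av$.
   Context: An involution of $A$ is a ring automorphism $a\mapsto a^*$ of order at most two (the identity is allowed). It is ramified if $\{a\in A:a^*=-a\}\subset\mathfrak r$ (equivalently, the induced involution on $A/\mathfrak r$ is trivial). Complete means that $\bigcap_{i\ge1}\mathfrak r^i=0$ and $A$ is complete for its $\mathfrak r$-adic metric. A map $h:V\times V\to A$ is a skew hermitian form if it is bi-additive, $A$-linear in the second variable, and $h(y,x)=-h(x,y)^*$ for all $x,y\in V$. A symplectic pair is an ordered pair $(x,y)\in V^2$ with $h(x,x)=h(y,y)=0$ and $h(x,y)=-h(y,x)=1$. *)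

(* Defs.v *)
From HB Require Import structures.
From mathcomp Require Import all_boot all_order all_algebra.
From mathcomp Require Import boolp classical_sets.
Set Implicit Arguments.
Unset Strict Implicit.
Unset Printing Implicit Defensive.
Import GRing.Theory.
Local Open Scope classical_set_scope.
Local Open Scope ring_scope.

Section Ideals.
Variable A : comUnitRingType.
Implicit Types I J r : set A.

(* [idealr_closed] requires [1 \notin I]: it describes the proper ideals. *)
Definition proper_ideal_set I : Prop := idealr_closed (mem I).

Definition maximal_ideal I : Prop :=
  proper_ideal_set I /\
  forall J, proper_ideal_set J -> I `<=` J -> J = I.

Definition local_ring_with r : Prop :=
  maximal_ideal r /\ forall I, maximal_ideal I -> I = r.

Definition ideal_mul I J : set A :=
  [set x | exists n (a b : 'I_n -> A),
     [/\ forall i, I (a i), forall i, J (b i) & x = \sum_(i < n) a i * b i]].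

Definition ideal_exp r (i : nat) : set A := iter i (ideal_mul r) setT.

(* Since the balls of the r-adic metric around [l] are the cosets [l + r^i],
   the metric notions of Cauchy and convergent sequence read as follows. *)
Definition adic_cauchy r (s : nat -> A) : Prop :=
  forall i, exists N, forall p q, (N <= p)%N -> (N <= q)%N ->
    ideal_exp r i (s p - s q).

Definition adic_cvg r (s : nat -> A) (l : A) : Prop :=
  forall i, exists N, forall p, (N <= p)%N -> ideal_exp r i (s p - l).

Definition adic_complete r : Prop :=
  \bigcap_(i in [set i | (1 <= i)%N]) ideal_exp r i = [set 0] /\
  forall s, adic_cauchy r s -> exists l, adic_cvg r s l.

Definition ramified r (star : A -> A) : Prop :=
  [set a | star a = - a] `<=` r.

End Ideals.

Section Forms.
Variables (A : comUnitRingType) (V : lmodType A).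

(* The library's [{hermitian V for _ & _}] is linear in the first variable;
   here linearity is in the second one. *)
Record skew_hermitian (star : A -> A) (h : V -> V -> A) : Prop :=
  SkewHermitian {
    skew_hermitian_addl : forall x y z, h (x + y) z = h x z + h y z;
    skew_hermitian_addr : forall x y z, h x (y + z) = h x y + h x z;
    skew_hermitian_scaler : forall a x y, h x (a *: y) = a * h x y;
    skew_hermitian_sym : forall x y, h y x = - star (h x y)
  }.

Definition symplectic_pair (h : V -> V -> A) (x y : V) : Prop :=
  [/\ h x x = 0, h y y = 0, h x y = 1 & - h y x = 1].

Definition span2 (x y : V) : set V :=
  [set w | exists a b : A, w = a *: x + b *: y].

End Forms.

(* Main.v *)
(* Skew elements lie in r, so Gram matrices of u, v with h u v = 1 have diagonal
   entries a, b in r.  For skew t, the vector u + t v is isotropic iff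
   t = (b t^2 - a) / 2; as b is in r, the right-hand side is an r-adic
   contraction, hence has a unique fixed point.  Since - t^* is a fixed point as
   well, t is skew.  Then h (u + t v) v = 1 - t b is invertible, its inverse being
   the fixed point of the contraction s |-> 1 + t b s, and once v is rescaled it
   can be made isotropic by adding half of h v v times the first vector. *)
Require Import Defs.
From mathcomp Require Import all_boot all_order all_algebra.
From mathcomp Require Import boolp classical_sets.
From mathcomp Require Import ring.
Set Implicit Arguments.
Unset Strict Implicit.
Import GRing.Theory.
Local Open Scope ring_scope.

Section AdicContraction.
Variables (A : comUnitRingType) (r : set A).

(** Ideals with the unit ideal allowed: [ideal_exp r 0] is all of [A], which [proper_ideal_set]
    excludes. *)
Definition linear_set (I : set A) : Prop :=
  I 0 /\ forall a x y, I x -> I y -> I (a * x + y).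

Lemma proper_ideal_linear (I : set A) : proper_ideal_set I -> linear_set I.
Proof.
case=> I0 _ Iax; split; first by move: I0; rewrite inE.
by move=> a x y Ix Iy; move: (Iax a x y); rewrite !inE; apply.
Qed.

Lemma ideal_mul_linear (I J : set A) : linear_set I -> linear_set (ideal_mul I J).
Proof.
move=> [_ Iax]; split.
  by exists 0, (fun=> 0), (fun=> 0); split; [case|case|rewrite big_ord0].
move=> c x y [n [a [b [Ia Jb ->]]]] [p [a' [b' [Ia' Jb' ->]]]].
have I0 z : I z -> I 0 by move=> Iz; have := Iax (-1) z z Iz Iz; rewrite mulN1r addNr.
exists (n + p)%N,
  (fun i => match split i with inl j => c * a j | inr k => a' k end),
  (fun i => match split i with inl j => b j | inr k => b' k end); split.
- move=> i; case: (split i) => // j; rewrite -[c * _]addr0.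
  by apply: Iax => //; apply: I0 (Ia j).
- by move=> i; case: (split i).
- rewrite big_split_ord /= mulr_sumr; congr (_ + _); apply: eq_bigr => i _.
    by rewrite (unsplitK (inl i)) mulrA.
  by rewrite (unsplitK (inr i)).
Qed.

Lemma ideal_mul_mem (I J : set A) (a b : A) : I a -> J b -> ideal_mul I J (a * b).
Proof.
by move=> Ia Jb; exists 1, (fun=> a), (fun=> b); split=> //; rewrite big_ord1.
Qed.

Lemma ideal_exp_linear i : linear_set r -> linear_set (ideal_exp r i).
Proof. by move=> rP; case: i => [//|i]; apply: ideal_mul_linear. Qed.

Lemma linear_setD (I : set A) x y : linear_set I -> I x -> I y -> I (x + y).
Proof. by case=> _ Iax Ix Iy; rewrite -[x]mul1r; apply: Iax. Qed.

Lemma linear_setM (I : set A) a x : linear_set I -> I x -> I (a * x).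
Proof. by case=> I0 Iax Ix; rewrite -[_ * _]addr0; apply: Iax. Qed.

Lemma linear_setN (I : set A) x : linear_set I -> I x -> I (- x).
Proof. by move=> IP Ix; rewrite -mulN1r; apply: linear_setM. Qed.

Hypotheses (r_linear : linear_set r) (r_complete : adic_complete r).

Lemma adic_separated x : (forall i, ideal_exp r i x) -> x = 0.
Proof.
case: r_complete => capr _ xP.
suff : [set 0]%classic x by [].
by rewrite -capr => i _; apply: xP.
Qed.

(** The factor [c] may vary with [s] and [t]; lying in [r], it carries r^i into r^(i+1), which is
    the contraction in the adic metric. *)
Definition adic_contraction (T : A -> A) : Prop :=
  forall s t, exists2 c, r c & T s - T t = c * (s - t).

Variable T : A -> A.
Hypothesis T_contr : adic_contraction T.

Lemma contraction_exp i s t :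
  ideal_exp r i (s - t) -> ideal_exp r i.+1 (T s - T t).
Proof. by move=> st; have [c rc ->] := T_contr s t; apply: ideal_mul_mem. Qed.

(** [s - t] equals [T s - T t], so it climbs from each power of [r] to the next and lies in all of
    them. *)
Lemma contraction_fixpoint_uniq s t : T s = s -> T t = t -> s = t.
Proof.
move=> Ts Tt; apply: subr0_eq; apply: adic_separated; elim=> [//|i IH].
by rewrite -{1}Ts -Tt; apply: contraction_exp.
Qed.

Lemma contraction_fixpoint : exists t, T t = t.
Proof.
pose s n := iter n T 0.
(* Peel off [i] applications of [T] from both iterates: each gains one power, starting from r^0 =
   [A]. *)
have s_near i p q : (i <= p)%N -> (i <= q)%N -> ideal_exp r i (s p - s q).
  elim: i p q => [//|i IH] [//|p] [//|q] ip iq.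
  by apply: contraction_exp; apply: IH.
have [|t st] := proj2 r_complete s; first by move=> i; exists i; apply: s_near.
exists t; apply: subr0_eq; apply: adic_separated => i.
have iP := ideal_exp_linear i r_linear.
(* As [T] gains one power, [s p - t] in r^(i-1) suffices for [T (s p) - T t] to be in r^i; for
   [i = 0] nothing is to be shown. *)
have [N sN] := st i; have [N' sN'] := st i.-1.
pose p := maxn N (maxn N' i).
have pN : (N <= p)%N by rewrite leq_max leqnn.
have pN' : (N' <= p)%N by rewrite !leq_max leqnn orbT.
have pi : (i <= p)%N by rewrite !leq_max leqnn !orbT.
have -> : T t - t = - (T (s p) - T t) + (s p.+1 - s p + (s p - t)).
  by rewrite /s iterS; ring.
apply: linear_setD => //; last first.
  by apply: linear_setD; [|apply: s_near => //; apply: leqW|apply: sN].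
apply: linear_setN => //.
by case: i sN' {sN pN iP pi} @p pN' => [//|i] sN' p pN'; apply: contraction_exp; apply: sN'.
Qed.

End AdicContraction.

(** The iterates of [1 + x * s] from 0 are the partial sums of the geometric series. *)
Lemma adic_unit_1B (A : comUnitRingType) (r : set A) (x : A) :
  linear_set r -> adic_complete r -> r x -> 1 - x \is a GRing.unit.
Proof.
move=> rP rC rx.
have [|s sE] := @contraction_fixpoint A r rP rC (fun s => 1 + x * s).
  by move=> s t; exists x => //; ring.
by apply/unitrPr; exists s; rewrite mulrBl mul1r -[X in X - _]sE addrK.
Qed.

Lemma skew_quadratic_root (A : comUnitRingType) (r : set A)
    (star : {rmorphism A -> A}) (a b : A) :
  linear_set r -> adic_complete r -> (2%:R : A) \is a GRing.unit ->
  star a = - a -> star b = - b -> r b ->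
  exists t, star t = - t /\ a + 2%:R * t - t ^+ 2 * b = 0.
Proof.
move=> rP rC h2 aN bN rb.
pose T t := (t ^+ 2 * b - a) / 2%:R.
have T_contr : adic_contraction r T.
  (* Difference of two squares: the remaining factor is [s - t]. *)
  move=> s t; exists ((s + t) / 2%:R * b); first exact: linear_setM.
  by rewrite /T; ring.
have [t tE] := contraction_fixpoint rP rC T_contr.
exists t; split; last first.
  have {1}<- := tE; rewrite /T mulrC divrK //; ring.
(* Applying [star] to [T t = t] flips the signs of [a] and [b], which makes [- star t] a fixed
   point; uniqueness concludes. *)
rewrite -[star t]opprK; congr (- _).
apply: (contraction_fixpoint_uniq rC T_contr) => //.
rewrite -{2}tE /T rmorphM rmorphV // rmorph_nat rmorphB rmorphM rmorphXn aN bN.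
ring.
Qed.

Section Span.
Variables (A : comUnitRingType) (V : lmodType A).
Implicit Types x y : V.

Lemma span2_sub x y x' y' :
  span2 x y x' -> span2 x y y' -> (span2 x' y' `<=` span2 x y)%classic.
Proof.
move=> [a [b ->]] [c [d ->]] _ [e [f ->]].
exists (e * a + f * c), (e * b + f * d).
by rewrite !scalerDr !scalerA !scalerDl addrACA.
Qed.

Lemma span2_l x y : span2 x y x.
Proof. by exists 1, 0; rewrite scale1r scale0r addr0. Qed.

Lemma span2_r x y : span2 x y y.
Proof. by exists 0, 1; rewrite scale1r scale0r add0r. Qed.

Lemma span2C x y : span2 x y = span2 y x.
Proof.
by rewrite eqEsubset; split; apply: span2_sub; (apply: span2_l || apply: span2_r).
Qed.

Lemma span2_addr x y s : span2 x (y + s *: x) = span2 x y.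
Proof.
rewrite eqEsubset; split; apply: span2_sub; try exact: span2_l.
  by exists s, 1; rewrite scale1r addrC.
by exists (- s), 1; rewrite scale1r scaleNr addrC addrK.
Qed.

Lemma span2_scaler x y c : c \is a GRing.unit -> span2 x (c *: y) = span2 x y.
Proof.
move=> cU; rewrite eqEsubset; split; apply: span2_sub; try exact: span2_l.
  by exists 0, c; rewrite scale0r add0r.
by exists 0, c^-1; rewrite scale0r add0r scalerA mulVr // scale1r.
Qed.

End Span.

Section SkewHermitian.
Variables (A : comUnitRingType) (V : lmodType A) (star : {rmorphism A -> A}).
Variable h : V -> V -> A.
Hypothesis (hh : skew_hermitian star h).

Lemma skew_hermitian_scalel a x y : h (a *: x) y = star a * h x y.
Proof.
rewrite (skew_hermitian_sym hh y) (skew_hermitian_scaler hh) rmorphM.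
by rewrite (skew_hermitian_sym hh y x) mulrN.
Qed.

Lemma skew_hermitian_diag x : star (h x x) = - h x x.
Proof. by rewrite [in RHS](skew_hermitian_sym hh) opprK. Qed.

Lemma skew_hermitian_shear x y s :
  h (x + s *: y) (x + s *: y) =
  h x x + s * h x y - star s * star (h x y) + star s * s * h y y.
Proof.
rewrite (skew_hermitian_addl hh) !(skew_hermitian_addr hh) !skew_hermitian_scalel.
rewrite !(skew_hermitian_scaler hh) (skew_hermitian_sym hh x y); ring.
Qed.

(** With [s] half of [h y y], hence skew, and [h y x = -1], each cross term of the shear contributes
    [- s], and together they cancel [h y y]. *)
Lemma symplectic_completion x y :
  (2%:R : A) \is a GRing.unit -> h x x = 0 -> h x y = 1 ->
  symplectic_pair h x (y + (h y y / 2%:R) *: x).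
Proof.
move=> h2 hxx hxy; set s := h y y / 2%:R.
have hyx : h y x = -1 by rewrite (skew_hermitian_sym hh) hxy rmorph1.
have hxy' : h x (y + s *: x) = 1.
  by rewrite (skew_hermitian_addr hh) (skew_hermitian_scaler hh) hxx hxy mulr0 addr0.
split=> //; last by rewrite (skew_hermitian_sym hh) hxy' rmorph1 opprK.
have sN : star s = - s.
  by rewrite rmorphM rmorphV // rmorph_nat skew_hermitian_diag mulNr.
rewrite skew_hermitian_shear sN hyx hxx rmorphN1.
have -> : h y y = s * 2%:R by rewrite divrK.
ring.
Qed.

End SkewHermitian.

Unset Implicit Arguments.

(* [V : vectType A] with [dim V = m] is a free A-module of rank m. *)
Theorem lemma5 (A : comUnitRingType) (r : set A)
  (hlocal : local_ring_with r) (hcomplete : adic_complete r)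
  (h2 : (2%:R : A) \is a GRing.unit)
  (star : {rmorphism A -> A}) (hinv : involutive star)
  (hram : ramified r star)
  (m : nat) (hm : (0 < m)%N) (V : vectType A) (hV : dim V = m)
  (h : V -> V -> A) (hh : skew_hermitian star h)
  (u v : V) (huv : h u v \is a GRing.unit) :
  exists u' v' : V, symplectic_pair h u' v' /\ span2 u' v' = span2 u v.
Proof.
have rP : linear_set r by apply: proper_ideal_linear; case: hlocal => [[]].
have diag_r x : r (h x x) by apply: hram; apply: skew_hermitian_diag hh x.
have hscale := skew_hermitian_scaler hh.
(* Rescaling the second vector, where [h] is linear, keeps [star] out of the factor. *)
pose w := (h u v)^-1 *: v.
have huw : h u w = 1 by rewrite hscale mulVr.
have [t [tN tE]] := skew_quadratic_root rP hcomplete h2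
  (skew_hermitian_diag hh u) (skew_hermitian_diag hh w) (diag_r w).
pose u' := u + t *: w.
have hu'u' : h u' u' = 0.
  (* For skew [t] the two cross terms add up to [2 t] and [star t * t] is [- t ^+ 2], so the shear
     formula is the quadratic of [tE]. *)
  rewrite (skew_hermitian_shear hh) huw tN rmorph1 -[RHS]tE; ring.
have hu'w : h u' w = 1 - t * h w w.
  by rewrite (skew_hermitian_addl hh) (skew_hermitian_scalel hh) huw tN mulNr.
have hu'wU : h u' w \is a GRing.unit.
  by rewrite hu'w; apply: (adic_unit_1B (r:=r)) => //; apply: linear_setM.
pose w' := (h u' w)^-1 *: w.
exists u', (w' + (h w' w' / 2%:R) *: u'); split.
  by apply: (symplectic_completion hh) => //; rewrite hscale mulVr.
(* The shears and unit rescalings are undone from last to first; swapping the pair lets [span2_addr]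
   act on its first vector. *)
rewrite span2_addr span2_scaler ?unitrV // span2C span2_addr span2C.
by rewrite span2_scaler ?unitrV.
Qed.
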